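(* Let $q$ be a prime power and $k\ge 3$ an integer. For $d=3$, a non-negative integer $r$ satisfies the ZLL condition with parameters $(q,k,d,r)$ if and only if $r\ge \log_q((q-1)k+1)$. Moreover, $$ k-\log_q\big(A_q(k,3)\big)\ \ge\ \log_q\big((q-1)k+1\big),$$ i.e., the lower bound $r\ge k-\log_q(A_q(k,3))$ on the redundancy of systematic $q$-ary codes with $q^k$ codewords and minimum distance $3$ is at least as strong as the one given by the ZLL condition.
   Context: $A_q(n,d)$ is the maximum number of codewords in any $q$-ary code of length $n$ in which distinct codewords are at Hamming distance at least $d$ (with $A_q(0,d)=1$). $B_m^k$ denotes a Hamming ball of radius $m$ in $\mathbb{F}_q^k$. The ZLL (Zinoviev–Litsyn–Laihonen) condition with parameters $(q,k,d,r)$, a known necessary condition for the existence of a systematic $(k+r,q^k,d)_q$ code, is: $|B_m^k|\le A_q(r,d-2m)$ for every integer $m$ with $0\le m\le\lfloor\frac{d-1}{2}\rfloor$. *)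

(* Defs.v *)
From mathcomp Require Import all_boot all_order all_algebra.
From mathcomp Require Import reals exp.

Set Implicit Arguments.
Unset Strict Implicit.
Unset Printing Implicit Defensive.

Import Order.TTheory GRing.Theory Num.Theory.

Definition hamming_dist (T : eqType) (n : nat) (x y : 'rV[T]_n) : nat :=
  #|[set i : 'I_n | x ord0 i != y ord0 i]|.

(* The ball B_m^k in F^k; its cardinality does not depend on the centre,
   which is taken to be 0. *)
Definition hamming_ball (F : finFieldType) (k m : nat) : {set 'rV[F]_k} :=
  [set x : 'rV[F]_k | hamming_dist 0%R x <= m].

Definition distance_at_least (T : finType) (n d : nat) (C : {set 'rV[T]_n}) :
    bool :=
  [forall x in C, forall y in C, (x != y) ==> (d <= hamming_dist x y)].

(* A_q(n, d) for the alphabet T, with q = #|T|.  Since 'rV[T]_0 has exactly one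
   element, the convention A_q(0, d) = 1 holds by definition. *)
Definition max_code_size (T : finType) (n d : nat) : nat :=
  \max_(C : {set 'rV[T]_n} | distance_at_least d C) #|C|.

(* The ZLL condition with parameters (q, k, d, r), where q = #|F|.
   The subtraction d - 2 * m is never truncated when d > 0. *)
Definition ZLL (F : finFieldType) (k d r : nat) : Prop :=
  forall m : nat, m <= (d - 1) %/ 2 ->
    #|hamming_ball F k m| <= max_code_size F r (d - 2 * m).

Definition log_base (R : realType) (b x : R) : R := (ln x / ln b)%R.

(* Main.v *)
Require Import Defs.
From mathcomp Require Import all_boot all_order all_algebra.
From mathcomp Require Import reals exp.

Import Order.TTheory GRing.Theory Num.Theory.
Local Open Scope ring_scope.

(** For [d = 3] the case [m = 0] of the ZLL condition is trivial, and the case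
    [m = 1] reads [(q - 1) k + 1 <= q ^ r], since every code has minimum
    distance at least 1.  The comparison of the two bounds on the redundancy is
    then the sphere-packing bound [A_q(k,3) * ((q - 1) k + 1) <= q ^ k] in
    logarithmic form. *)

Lemma card_row (T : finType) (n : nat) : #|{: 'rV[T]_n}| = (#|T| ^ n)%N.
Proof. by rewrite card_mx mul1n. Qed.

Lemma hamming_dist_eq0 {T : eqType} {n : nat} (x y : 'rV[T]_n) :
  (hamming_dist x y == 0%N) = (x == y).
Proof.
rewrite /hamming_dist cards_eq0; apply/eqP/eqP => [xy | ->].
  apply/rowP => i; apply/eqP; apply/negPn; apply/negP => nxy.
  by have := in_set0 i; rewrite -xy inE nxy.
by apply/setP => i; rewrite !inE eqxx.
Qed.

(** A one-word code has no two distinct words, so it meets every distance requirement. *)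
Lemma max_code_size_gt0 (T : finType) (n d : nat) :
  (0 < #|T|)%N -> (0 < max_code_size T n d)%N.
Proof.
case/card_gt0P => a _; pose x : 'rV[T]_n := const_mx a.
have : (#|[set x]| <= max_code_size T n d)%N; last by rewrite cards1.
apply: (leq_bigmax_cond (P := distance_at_least d)).
apply/forall_inP => y /set1P ->; apply/forall_inP => z /set1P ->.
by rewrite eqxx.
Qed.

Lemma max_code_size_attained (T : finType) (n d : nat) :
  exists2 C : {set 'rV[T]_n}, distance_at_least d C & max_code_size T n d = #|C|.
Proof.
have [|C dC CE] := @eq_bigmax_cond _ (@distance_at_least T n d) (fun C => #|C|).
  by apply/card_gt0P; exists set0; apply/forall_inP => x; rewrite inE.
by exists C.
Qed.

(** Distinct words differ in some position, so the whole space is itself a code of minimum distance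
    1. *)
Lemma max_code_size_dist1 (T : finType) (n : nat) :
  max_code_size T n 1 = (#|T| ^ n)%N.
Proof.
apply/eqP; rewrite eqn_leq; apply/andP; split.
  by apply/bigmax_leqP => C _; rewrite -card_row max_card.
rewrite -card_row -cardsT.
apply: (leq_bigmax_cond (P := distance_at_least 1)).
apply/forall_inP => x _; apply/forall_inP => y _; apply/implyP.
by rewrite lt0n hamming_dist_eq0.
Qed.

Section HammingBall.
Variable F : finFieldType.

Lemma card_hamming_ball0 (k : nat) : #|hamming_ball F k 0| = 1%N.
Proof.
suff -> : hamming_ball F k 0 = [set 0] by rewrite cards1.
apply/setP => x.
by rewrite !inE leqn0 hamming_dist_eq0 eq_sym.
Qed.

Lemma hamming_ball1P (k : nat) (x : 'rV[F]_k) :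
  reflect (x = 0 \/ exists i a, a != 0 /\ x = a *: delta_mx 0 i)
          (x \in hamming_ball F k 1).
Proof.
rewrite inE leq_eqVlt ltnS leqn0 hamming_dist_eq0.
apply: (iffP orP) => [[/cards1P[i suppx] | /eqP <-] | [-> | [i [a [a0 ->]]]]].
(* The support of [x] is the single position [i], so the scalar has to be the entry of [x] there. *)
- right; exists i, (x 0 i); split.
    by have := set11 i; rewrite -suppx inE mxE eq_sym.
  apply/rowP => j; rewrite !mxE eqxx /=.
  have [-> | nji] := eqVneq j i; first by rewrite mulr1.
  rewrite mulr0; apply/eqP; apply: contraNT nji => xj.
  by rewrite -in_set1 -suppx inE mxE eq_sym.
- by left.
- by right.
- left; apply/cards1P; exists i; apply/setP => j.
  rewrite !inE !mxE eqxx eq_sym.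
  by have [_ | _] := eqVneq j i; rewrite ?mulr1 ?mulr0 ?eqxx.
Qed.

(** Apart from the centre, the ball is parametrized injectively by the pairs of a nonzero scalar and
    a position. *)
Lemma card_hamming_ball1 (k : nat) :
  #|hamming_ball F k 1| = (#|F|.-1 * k + 1)%N.
Proof.
pose f (u : F * 'I_k) : 'rV[F]_k := u.1 *: delta_mx 0 u.2.
pose D := setX [set~ (0 : F)] [set: 'I_k].
have fE u j : f u 0 j = u.1 * (j == u.2)%:R by rewrite !mxE eqxx.
have nz u : u \in D -> u.1 != 0 by case: u => a i; rewrite !inE andbT.
have -> : hamming_ball F k 1 = 0 |: f @: D.
  apply/setP => x; apply/hamming_ball1P/setU1P.
    move=> [-> | [i [a [a0 ->]]]]; [by left | right].
    by apply/imsetP; exists (a, i) => //; rewrite !inE a0.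
  move=> [-> | /imsetP[u /nz u0 ->]]; [by left | right].
  by exists u.2, u.1.
have nz0 : 0 \notin f @: D.
  apply/imsetP => -[u /nz u0 /rowP/(_ u.2)/eqP].
  by rewrite fE mxE eqxx mulr1 eq_sym (negPf u0).
have finj : {in D &, injective f}.
  (* Coordinate [i] suffices: the left word has entry [a != 0] there, which forces [j = i] and then
     [b = a]. *)
  move=> [a i] [b j] /nz /= a0 _ /rowP /(_ i); rewrite !fE /= eqxx mulr1.
  have [-> | _] := eqVneq i j; first by rewrite mulr1 => ->.
  by rewrite mulr0 => a_eq0; rewrite a_eq0 eqxx in a0.
rewrite cardsU1 nz0 card_in_imset // cardsX cardsC1 cardsT card_ord.
by rewrite addnC.
Qed.

(* Words [c + b] and [c' + b'] with [b], [b'] in the ball can only coincide if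
   [c] and [c'] differ at most on the supports of [b] and [b']. *)
Lemma hamming_dist_le_translate {k m : nat} {c c' b b' : 'rV[F]_k} :
    b \in hamming_ball F k m -> b' \in hamming_ball F k m ->
    c + b = c' + b' ->
  (hamming_dist c c' <= m + m)%N.
Proof.
rewrite !inE => hb hb' /rowP E.
apply: leq_trans (leq_add hb hb'); apply: leq_trans (leq_card_setU _ _).
apply/subset_leq_card/subsetP => i; rewrite !inE !mxE.
apply: contraR; rewrite negb_or !negbK => /andP[/eqP bi /eqP b'i].
by move: (E i); rewrite !mxE -bi -b'i !addr0 => ->.
Qed.

(** For an optimal code [C], the map sending [(c, b)] to [c + b] is injective on [C] times the ball:
    a collision between distinct codewords would put them at distance at most [m + m < d]. *)
Lemma sphere_packing_bound (k d m : nat) : (m + m < d)%N ->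
  (max_code_size F k d * #|hamming_ball F k m| <= #|F| ^ k)%N.
Proof.
move=> md; have [C dC ->] := max_code_size_attained F k d.
rewrite -card_row -cardsX -(card_in_imset (f := fun u => u.1 + u.2)).
  exact: max_card.
move=> [c b] [c' b'] /setXP[/= cC bB] /setXP[/= c'C b'B] E.
have ccE : c = c'.
  apply/eqP; apply: contraTT md => ncc; rewrite -leqNgt.
  apply: leq_trans (hamming_dist_le_translate bB b'B E).
  by move/forall_inP/(_ c cC)/forall_inP/(_ c' c'C)/implyP: dC; apply.
by move: E; rewrite ccE => /addrI ->.
Qed.

Lemma ZLL_dist3 (k r : nat) :
  ZLL F k 3 r <-> (#|F|.-1 * k + 1 <= #|F| ^ r)%N.
Proof.
rewrite -card_hamming_ball1 -max_code_size_dist1.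
split=> [zll | ball1]; first exact: (zll 1%N).
(* Only [m = 0] and [m = 1] occur, since [(3 - 1) %/ 2 = 1]; for [m = 1] the remaining distance is
   [3 - 2 = 1]. *)
case=> [_ | [_ | //]]; last exact: ball1.
by rewrite card_hamming_ball0 max_code_size_gt0 // ltnW // card_finNzRing_gt1.
Qed.

End HammingBall.

(** Multiplying by [ln q > 0] gives [ln N <= ln (q ^ r)], and [ln] is increasing on the positive
    reals. *)
Lemma ler_log_base (R : realType) (q N r : nat) : (1 < q)%N -> (0 < N)%N ->
  (log_base q%:R N%:R <= r%:R :> R) = (N <= q ^ r)%N.
Proof.
move=> q1 N0; have lnq : 0 < ln (q%:R : R) by rewrite ln_gt0 // ltr1n.
rewrite /log_base ler_pdivrMr // mulr_natl -lnXn ?ltr0n ?(ltnW q1) //.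
by rewrite ler_ln ?posrE ?exprn_gt0 ?ltr0n ?(ltnW q1) // -natrX ler_nat.
Qed.

Lemma log_baseM (R : realType) (b x y : R) : 0 < x -> 0 < y ->
  log_base b (x * y) = log_base b x + log_base b y.
Proof. by move=> x0 y0; rewrite /log_base lnM // mulrDl. Qed.

Theorem mainTheorem5 (R : realType) (F : finFieldType) (q k : nat)
    (hq : #|F| = q) (hk : (3 <= k)%N) :
  [/\ forall r : nat,
        ZLL F k 3 r <->
        r%:R >= log_base q%:R ((q%:R - 1) * k%:R + 1) :> R,
      k%:R - log_base q%:R (max_code_size F k 3)%:R
        >= log_base q%:R ((q%:R - 1) * k%:R + 1) :> R
    & forall r : nat,
        r%:R >= k%:R - log_base q%:R (max_code_size F k 3)%:R :> R ->
        ZLL F k 3 r].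
Proof.
have q1 : (1 < q)%N by rewrite -hq card_finNzRing_gt1.
have ballE : (q%:R - 1) * k%:R + 1 = (q.-1 * k + 1)%:R :> R.
  by rewrite natrD natrM -subn1 natrB // ltnW.
have ball_gt0 : (0 < q.-1 * k + 1)%N by rewrite addn1.
have code_gt0 : (0 < max_code_size F k 3)%N.
  by rewrite max_code_size_gt0 // hq ltnW.
have zllE r : ZLL F k 3 r <->
    r%:R >= log_base q%:R ((q%:R - 1) * k%:R + 1) :> R.
  by rewrite ballE ler_log_base // -hq; exact: ZLL_dist3.
have bound : k%:R - log_base q%:R (max_code_size F k 3)%:R
    >= log_base q%:R ((q%:R - 1) * k%:R + 1) :> R.
  (* Moving the logarithm of the code size across leaves the logarithm of code size times ball size,
     bounded by [k]: sphere packing with [m = 1], as [1 + 1 < 3]. *)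
  rewrite ballE lerBrDl -log_baseM ?ltr0n // -natrM ler_log_base //.
    by rewrite -hq -card_hamming_ball1 sphere_packing_bound.
  by rewrite muln_gt0 code_gt0.
by split=> // r hr; apply/zllE; exact: le_trans bound hr.
Qed.
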